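(* Let $n\geq 1$. List the set of partitions of $n$ in weakly increasing order of crank, and separately in weakly increasing order of rank; ties may be broken arbitrarily in each list. Define $\tau_n$ as the bijection on the set of partitions of $n$ that sends the $i$-th partition in the crank-ordered list to the $i$-th partition in the rank-ordered list. Then for every partition $\lambda$ of $n$, \[ \operatorname{crank}(\lambda)-\operatorname{rank}(\tau_n(\lambda))=\begin{cases}0 & \text{if } \operatorname{crank}(\lambda)=0,\\ 0\text{ or }1 & \text{if } \operatorname{crank}(\lambda)>0,\\ 0\text{ or }-1 & \text{if } \operatorname{crank}(\lambda)<0.\end{cases} \]
   Context: For a partition $\lambda$, $\operatorname{rank}(\lambda)$ is its largest part minus its number of parts. $\operatorname{crank}(\lambda)$ is the largest part of $\lambda$ if $\lambda$ contains no part equal to $1$; otherwise it is the number of parts larger than the number of ones minus the number of ones. *)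

(* Defs.v *)
From mathcomp Require Import all_boot all_order all_algebra.
Set Implicit Arguments. Unset Strict Implicit. Unset Printing Implicit Defensive.
Import GRing.Theory Num.Theory.

Definition is_partition (n : nat) (s : seq nat) : bool :=
  [&& sorted geq s, all (fun x => 0 < x)%N s & sumn s == n]%N.

Definition largest_part (s : seq nat) : nat := foldr maxn 0 s.

Definition num_ones (s : seq nat) : nat := count (pred1 1) s.

Definition prank (s : seq nat) : int := ((largest_part s)%:Z - (size s)%:Z)%R.

Definition pcrank (s : seq nat) : int :=
  let w := num_ones s in
  if w == 0 then ((largest_part s)%:Z)%R
  else ((count (fun x => (w < x)%N) s)%:Z - w%:Z)%R.

Definition enum_partitions (n : nat) (L : seq (seq nat)) : Prop :=
  uniq L /\ forall s, (s \in L) = is_partition n s.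

(* Main.v *)
(* Let C(r) and N(r) be the numbers of partitions of n with crank, resp. rank,
   at least r.  For n >= 2 both statistics are symmetric, so the theorem amounts
   to N(r) <= C(r) <= N(r - 1) for r >= 1.

   Both sides count pairs (A, B) of finite sets of integers whose elements have
   sum E = n + m(m + 1)/2, where m = r - 1.  By the exact formula
     #{crank = k} = [q^n] (1 - q) sum_w q^(w + (w + 1)(w + k)) / ((q)_w (q)_(w + k)),
   C(r) is the number of pairs with A, B >= 1 and |B| - |A| = r; by Durfee
   rectangles, N(r) is the number of pairs with A >= 0, B >= 1, |B| - |A| = m and
   max B <= max A + m.  Slicing these sets according to max A and max B turns
   N(r - 1) - C(r) and C(r) - N(r) into sums of coefficients of z^d in products
     prod_(i in I) (1 + q^i / z) * prod_(j in J) (1 + z q^j)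
   over intervals I, J.  The first sum is nonnegative after an index shift.  The
   second reduces, after cancellations, to the fact that for I = J the
   coefficients of z^d decrease in steps of 2 away from d = 0 (exchange of one
   element between A and B), except for one sum whose positivity only appears
   after Abel summation, that is after multiplication by 1 - q^2. *)
Require Import Defs.
From mathcomp Require Import all_boot all_order all_algebra.
From mathcomp Require Import zify ring.
Import Order.TTheory GRing.Theory Num.Theory.
Set Implicit Arguments. Unset Strict Implicit. Unset Printing Implicit Defensive.
Local Open Scope ring_scope.

(** * Products of factors 1 + q^i / z and 1 + z q^j *)

(* Laurent polynomials in z over Z[q], as functions of the exponent of z;
   q is the polynomial variable 'X. *)
Definition laurent := int -> {poly int}.

Definition mulA (i : nat) (F : laurent) : laurent := fun d => F d + 'X^i * F (d + 1).
Definition mulB (i : nat) (F : laurent) : laurent := fun d => F d + 'X^i * F (d - 1).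
Definition delta0 : laurent := fun d => (d == 0)%:R.

(* [W sA a sB b] is the product of the factors 1 + q^i / z for sA <= i < sA + a
   and 1 + z q^j for sB <= j < sB + b. *)
Definition W (sA a sB b : nat) : laurent :=
  foldr mulA (foldr mulB delta0 (iota sB b)) (iota sA a).

Lemma W_Afst sA a sB b d :
  W sA a.+1 sB b d = W sA.+1 a sB b d + 'X^sA * W sA.+1 a sB b (d + 1).
Proof. by []. Qed.

Lemma W_Alst sA a sB b d :
  W sA a.+1 sB b d = W sA a sB b d + 'X^(sA + a) * W sA a sB b (d + 1).
Proof.
elim: a sA d => [|a IH] sA d; first by rewrite W_Afst addn0.
rewrite W_Afst (IH sA.+1 d) (IH sA.+1 (d + 1)) [W sA a.+1 _ _ d]W_Afst.
rewrite [W sA a.+1 _ _ (d + 1)]W_Afst addSnnS; ring.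
Qed.

Lemma W_Bfst sA a sB b d :
  W sA a sB b.+1 d = W sA a sB.+1 b d + 'X^sB * W sA a sB.+1 b (d - 1).
Proof.
elim: a sA d => [|a IH] sA d; first by [].
rewrite !W_Afst !IH addrK subrK; ring.
Qed.

Lemma W_Blst sA a sB b d :
  W sA a sB b.+1 d = W sA a sB b d + 'X^(sB + b) * W sA a sB b (d - 1).
Proof.
elim: b sB d => [|b IH] sB d; first by rewrite W_Bfst addn0.
rewrite W_Bfst (IH sB.+1 d) (IH sB.+1 (d - 1)) [W _ _ sB b.+1 d]W_Bfst.
rewrite [W _ _ sB b.+1 (d - 1)]W_Bfst addSnnS; ring.
Qed.

Lemma W00 sA sB d : W sA 0 sB 0 d = (d == 0)%:R.
Proof. by []. Qed.

Lemma W_gt sA a sB b (d : int) : (b%:Z < d) -> W sA a sB b d = 0.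
Proof.
elim: a sA d => [|a IH] sA d Hd.
  elim: b sB d Hd => [|b IHb] sB d Hd; first by rewrite W00; case: eqP => //; lia.
  by rewrite W_Bfst !IHb ?mulr0 ?addr0 //; lia.
by rewrite W_Afst !IH ?mulr0 ?addr0 //; lia.
Qed.

(* Substituting z q for z. *)
Lemma W_shift sA a sB b (d : int) (e1 e2 : nat) : e1%:Z = d + e2%:Z ->
  'X^e2 * W sA a sB.+1 b d = 'X^e1 * W sA.+1 a sB b d.
Proof.
elim: a sA d e1 e2 => [|a IH] sA d e1 e2 He.
  elim: b sB d e1 e2 He => [|b IHb] sB d e1 e2 He.
    rewrite !W00; case: eqP => [d0|]; last by rewrite !mulr0.
    by have -> : e1 = e2 by lia.
  rewrite !W_Bfst !mulrDr !mulrA -!exprD; congr (_ + _); first exact: IHb.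
  by apply: IHb; lia.
rewrite !W_Afst !mulrDr !mulrA -!exprD; congr (_ + _); first exact: IH.
by apply: IH; lia.
Qed.

(** * Coefficientwise nonnegativity *)

Definition pos (p : {poly int}) := forall i, 0 <= p`_i.

Lemma pos0 : pos 0. Proof. by move=> i; rewrite coef0. Qed.
Lemma posD p q : pos p -> pos q -> pos (p + q).
Proof. by move=> hp hq i; rewrite coefD addr_ge0. Qed.
Lemma posX n p : pos p -> pos ('X^n * p).
Proof. by move=> hp i; rewrite mulrC coefMXn; case: ifP. Qed.
Lemma W_pos sA a sB b d : pos (W sA a sB b d).
Proof.
elim: a sA d => [|a IH] sA d; last by rewrite W_Afst; apply/posD/posX.
elim: b sB d => [|b IH] sB d; last by rewrite W_Bfst; apply/posD/posX.
by rewrite W00 => i; case: (d == 0); rewrite ?coef0 // coef1; case: eqP.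
Qed.

(** * Unimodality in z *)

(** In the variable z q^(tau / 2) this says that the coefficients decrease in steps of 2 from
    exponent t on. The factor ['X^tau] records the rescaling without half-integral powers of q. *)
Definition qdec (tau : nat) (t : int) (F : laurent) :=
  forall d, t <= d -> pos ('X^tau * F d - F (d + 2)).

Lemma qdecW tau t t' F : t <= t' -> qdec tau t F -> qdec tau t' F.
Proof. by move=> h H d hd; apply: H; lia. Qed.

Lemma qdec_A tau t F G i : qdec tau t F -> (forall d, G d = mulA i F d) -> qdec tau t G.
Proof.
move=> H E d hd; rewrite !E /mulA.
have -> : 'X^tau * (F d + 'X^i * F (d + 1)) - (F (d + 2) + 'X^i * F (d + 2 + 1))
  = ('X^tau * F d - F (d + 2)) + 'X^i * ('X^tau * F (d + 1) - F (d + 1 + 2)).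
  by rewrite (_ : d + 2 + 1 = d + 1 + 2); [ring|lia].
by apply: posD; [exact: H|apply/posX/H; lia].
Qed.

Lemma qdec_B tau t F G i : qdec tau t F -> (forall d, G d = mulB i F d) ->
  qdec tau (t + 1) G.
Proof.
move=> H E d hd; rewrite !E /mulB.
have -> : 'X^tau * (F d + 'X^i * F (d - 1)) - (F (d + 2) + 'X^i * F (d + 2 - 1))
  = ('X^tau * F d - F (d + 2)) + 'X^i * ('X^tau * F (d - 1) - F (d - 1 + 2)).
  by rewrite (_ : d + 2 - 1 = d - 1 + 2); [ring|lia].
by apply: posD; [apply: H; lia|apply/posX/H; lia].
Qed.

(** Replacing z by 1 / (z q^tau) exchanges 1 + q^i / z with 1 + z q^(i + tau). *)
Lemma W_sym sA tau a (d : int) (e1 e2 : nat) : e1%:Z = e2%:Z + tau%:Z * d ->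
  'X^e1 * W sA a (sA + tau) a (- d) = 'X^e2 * W sA a (sA + tau) a d.
Proof.
elim: a d e1 e2 => [|a IH] d e1 e2 He.
  rewrite !W00 oppr_eq0; case: eqP => [d0|]; last by rewrite !mulr0.
  by have -> : e1 = e2 by lia.
rewrite !W_Alst !W_Blst !addrK.
rewrite (_ : - d + 1 = - (d - 1)); last by lia.
rewrite (_ : - d - 1 = - (d + 1)); last by lia.
rewrite !mulrDr !mulrA -!exprD.
rewrite (IH d e1 e2) //.
rewrite (IH (d + 1) (e1 + (sA + tau + a))%N (e2 + (sA + a))%N); last by lia.
rewrite (IH (d - 1) (e1 + (sA + a))%N (e2 + (sA + tau + a))%N); last by lia.
rewrite (IH d (e1 + (sA + a) + (sA + tau + a))%N (e2 + (sA + a) + (sA + tau + a))%N).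
  ring.
lia.
Qed.

(* Each pair of factors (1 + q^i / z)(1 + z q^(i + tau)) is symmetric and
   unimodal in z q^(tau / 2), like the character of a representation of SU(2). *)
Lemma W_qdec sA tau a : qdec tau (-1) (W sA a (sA + tau) a).
Proof.
have sym b : 'X^tau * W sA b (sA + tau) b (-1) = W sA b (sA + tau) b 1.
  by rewrite (@W_sym sA tau b 1 tau 0) ?expr0 ?mul1r //; lia.
elim: a => [|a IH] d hd.
  rewrite !W00; have [->|h] := eqVneq d (-1).
    by rewrite /= mulr0 subr0; exact: pos0.
  rewrite (_ : (d + 2 == 0) = false); last by apply/eqP; lia.
  rewrite subr0; apply: posX.
  by case: (d == 0) => i; rewrite ?coef0 // coef1; case: eqP.
(* At [d = -1] the difference vanishes by symmetry. For larger d the indices [d - 1], [d] and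
   [d + 1] all stay in the range of the induction hypothesis. *)
have [->|h] := eqVneq d (-1); first by rewrite sym subrr; exact: pos0.
rewrite !W_Alst !W_Blst !addrK.
rewrite (_ : d + 2 + 1 = d + 1 + 2); last by lia.
rewrite (_ : d + 2 - 1 = d - 1 + 2); last by lia.
set G := W sA a (sA + tau) a in IH *.
set u := 'X^(sA + a); set v := 'X^(sA + tau + a).
rewrite [X in pos X](_ : _ = ('X^tau * G d - G (d + 2)) + u * (v * ('X^tau * G d - G (d + 2)))
  + u * ('X^tau * G (d + 1) - G (d + 1 + 2)) + v * ('X^tau * G (d - 1) - G (d - 1 + 2))).
  apply: posD; last by apply/posX/IH; lia.
  apply: posD; last by apply/posX/IH; lia.
  by apply: posD; [apply: IH; lia|apply/posX/posX/IH; lia].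
ring.
Qed.

Lemma W_qdec_B sA tau a n : qdec tau (n%:Z - 1) (W sA a (sA + tau) (a + n)).
Proof.
elim: n => [|n IH]; first by rewrite addn0; exact: W_qdec.
rewrite addnS; apply: (qdecW _ (qdec_B (i := sA + tau + (a + n)) IH _)); first by lia.
by move=> d; rewrite W_Blst.
Qed.

Lemma foldr_mulB_comm es e F d :
  foldr mulB (mulB e F) es d = mulB e (foldr mulB F es) d.
Proof.
by elim: es d => [|i es IH] d //=; rewrite /mulB -/(mulB e F) !IH /mulB; ring.
Qed.

Lemma W_Bextra sA a sB b n d :
  W sA a sB (b + n) d = foldr mulB (W sA a sB b) (iota (sB + b) n) d.
Proof.
elim: n b d => [|n IH] b d; first by rewrite addn0.
rewrite addnS -addSn IH addnS /= -foldr_mulB_comm.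
have E d' : W sA a sB b.+1 d' = mulB (sB + b) (W sA a sB b) d' by rewrite W_Blst.
elim: (iota _ n) d => [|i es IHe] d //=; by rewrite /mulB !IHe.
Qed.

Lemma qdec_foldB tau t F es :
  qdec tau t F -> qdec tau (t + (size es)%:Z) (foldr mulB F es).
Proof.
move=> H; elim: es => [|i es IH]; first by rewrite addr0.
by apply: (qdecW _ (qdec_B IH (fun _ => erefl))) => /=; lia.
Qed.

(** Two steps of [qdec 0] give this drop over distance 4 only from one exponent later. For the
    symmetric product the missing case [d = 0] is an equality, and that one exponent is what the
    pair argument needs. *)
Definition q2dec (t : int) (F : laurent) := forall d, t <= d -> pos (F (d - 2) - F (d + 2)).

Lemma q2dec_foldB t F es :
  q2dec t F -> q2dec (t + (size es)%:Z) (foldr mulB F es).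
Proof.
move=> H; elim: es => [|i es IH] /= d hd; first by apply: H; lia.
rewrite /mulB; set G := foldr mulB F es in IH *.
rewrite (_ : d - 2 - 1 = d - 1 - 2); last by lia.
rewrite (_ : d + 2 - 1 = d - 1 + 2); last by lia.
rewrite [X in pos X](_ : _ = (G (d - 2) - G (d + 2)) + 'X^i * (G (d - 1 - 2) - G (d - 1 + 2))).
  by apply: posD; [apply: IH; lia|apply/posX/IH; lia].
ring.
Qed.

Lemma W_q2dec sA a : q2dec 0 (W sA a sA a).
Proof.
move=> d hd; have := @W_qdec sA 0 a; rewrite addn0 => H.
have [->|d0] := eqVneq d 0.
  have := @W_sym sA 0 a 2 0 0 erefl; rewrite addn0 !expr0 !mul1r => E.
  by rewrite !add0r E subrr; exact: pos0.
rewrite -(subrKA (W sA a sA a d)); apply: posD.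
  have := H (d - 2); rewrite expr0 mul1r subrK; apply; lia.
have := H d; rewrite expr0 mul1r; apply; lia.
Qed.

(* Multiplying in the factor of the smallest unpaired element [sA + a] last lets
   the negative terms cancel. *)
Lemma W_qdec_pair sA a m (G := W sA a sA (a + m.+1)) :
  pos ((G (m%:Z - 1) - G (m%:Z + 1)) + 'X^(sA + a) * (G m%:Z - G (m%:Z + 2))).
Proof.
set H := foldr mulB (W sA a sA a) (iota (sA + a).+1 m).
have E d : G d = H d + 'X^(sA + a) * H (d - 1) by rewrite /G W_Bextra.
have H1 : qdec 0 (m%:Z - 1) H.
  have := @W_qdec sA 0 a; rewrite addn0 => /qdec_foldB -/(_ (iota (sA + a).+1 m)).
  rewrite size_iota; apply: qdecW; lia.
have H2 : q2dec m%:Z H.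
  have := @q2dec_foldB 0 _ (iota (sA + a).+1 m) (@W_q2dec sA a).
  by rewrite size_iota add0r.
rewrite !E addrK (_ : m%:Z + 2 - 1 = m%:Z + 1); last by lia.
rewrite (_ : m%:Z - 1 - 1 = m%:Z - 2); last by lia.
set u := 'X^(sA + a).
have := H1 (m%:Z - 1); rewrite (_ : m%:Z - 1 + 2 = m%:Z + 1); last by lia.
have := H2 m%:Z; rewrite expr0 mul1r.
move=> /(_ (lexx _)) p2 /(_ (lexx _)) p1.
rewrite [X in pos X](_ : _ = (H (m%:Z - 1) - H (m%:Z + 1)) + u * (H (m%:Z - 2) - H (m%:Z + 2))
   + u * (u * (H (m%:Z - 1) - H (m%:Z + 1)))).
  by apply: posD; [apply: posD => //; exact: posX|exact/posX/posX].
ring.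
Qed.

(** Pair i in A with i + 2 in B, which leaves 2 and 3 in B unpaired. Each unpaired B factor raises
    the threshold by one; an unpaired A factor, as occurs for [m = 0], leaves it alone. *)
Lemma W_qdec2 p m : qdec 2 (m%:Z + 1) (W 2 p 2 (p + m + 1)).
Proof.
have base p' : qdec 2 1 (W 2 p' 2 (p' + 2)).
  have E1 : qdec 2 0 (W 2 p' 3 p'.+1).
    apply: (qdecW _ (qdec_B (@W_qdec 2 2 p') (i := 3) _)) => // d.
    by rewrite W_Bfst.
  apply: (qdecW _ (qdec_B E1 (i := 2) _)) => // d.
  by rewrite addn2 W_Bfst.
have step n : qdec 2 (n%:Z + 1) (W 2 p 2 (p + 2 + n)).
  elim: n => [|n IH]; first by rewrite addn0; exact: base.
  rewrite addnS; apply: (qdecW _ (qdec_B IH (i := 2 + (p + 2 + n)) _)); first by lia.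
  by move=> d; rewrite W_Blst.
case: m => [|m]; last first.
  by rewrite (_ : p + m.+1 + 1 = p + 2 + m)%N; [apply: qdecW (step m); lia|lia].
case: p {step} => [|p] ; last first.
  rewrite (_ : p.+1 + 0 + 1 = p + 2)%N; last by lia.
  by apply: (qdec_A (i := 2 + p) (base p)) => d; rewrite W_Alst.
move=> d hd; rewrite (@W_gt 2 0 2 _ (d + 2)); last by lia.
by rewrite subr0; apply/posX/W_pos.
Qed.

(** * The inequalities as sums of products *)

(* The part of the difference C(r) - N(r) that is not nonnegative termwise. *)
Definition residual_sum (m M : nat) : {poly int} :=
  \sum_(p < M) ('X^(p + p) * (W 2 p 2 (p + m + 1) m - W 2 p 2 (p + m + 1) (m%:Z + 2))
                - 'X^(p + p + p + 2) * W 2 p 2 (p + m + 1) (m%:Z + 3)).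

(** The boundary term added to the sum turns each step of the induction into a difference of
    consecutive products. Expanding the two new factors splits it into the positive expressions of
    [W_qdec2] and [W_qdec_pair]. *)
Lemma residual_sum_abel m M :
  pos ((1 - 'X^2) * residual_sum m M
       + 'X^(M + M) * (W 2 M 2 (M + m + 1) m - W 2 M 2 (M + m + 1) (m%:Z + 2))).
Proof.
elim: M => [|M IH].
  rewrite /residual_sum big_ord0 mulr0 add0r (@W_gt _ _ _ _ (m%:Z + 2)); last by lia.
  by rewrite subr0; apply/posX/W_pos.
rewrite /residual_sum big_ord_recr /= -/(residual_sum m M).
rewrite !addSn !W_Alst !W_Blst.
have := @W_qdec2 M m _ (lexx _).
have := @W_qdec_pair 2 M m.
rewrite (_ : M + m.+1 = M + m + 1)%N; last by lia.
set k := W 2 M 2 (M + m + 1) in IH *.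
rewrite (_ : m%:Z + 2 + 1 - 1 = m%:Z + 2); last by lia.
rewrite (_ : m%:Z + 1 - 1 = m%:Z); last by lia.
rewrite (_ : m%:Z + 2 + 1 = m%:Z + 3); last by lia.
rewrite (_ : m%:Z + 2 - 1 = m%:Z + 1); last by lia.
rewrite (_ : m%:Z + 1 + 2 = m%:Z + 3); last by lia.
move=> h1 h2; rewrite [X in pos X](_ : _ =
  ((1 - 'X^2) * residual_sum m M + 'X^(M + M) * (k m%:Z - k (m%:Z + 2)))
  + 'X^(M + M + M + 2) * ('X^2 * k (m%:Z + 1) - k (m%:Z + 3))
  + 'X^(M + M + M + m + 5) * (k (m%:Z - 1) - k (m%:Z + 1) + 'X^(2 + M) * (k m%:Z - k (m%:Z + 2)))).
  by apply: posD; [apply: posD => //; exact: posX|exact: posX].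
rewrite !(addnS, addSn, addn0, add0n) !(exprS, exprD, expr0); ring.
Qed.

(** Below degree 2M the boundary term is invisible, so each coefficient is at least the one two
    degrees lower. *)
Lemma residual_sum_ge0 m M i : (i < M + M)%N -> 0 <= (residual_sum m M)`_i.
Proof.
elim/ltn_ind: i => i IH iM.
have := residual_sum_abel m M i.
rewrite coefD mulrBl mul1r coefB ![ 'X^_ * _]mulrC !coefMXn iM addr0.
case: ltnP => [_|i2]; first by rewrite subr0.
rewrite subr_ge0; apply: le_trans; apply: IH; lia.
Qed.

Lemma W_Bone x b (m : nat) :
  W 1 x 1 b.+1 (m%:Z + 1) = 'X^(m + 1) * (W 2 x 1 b (m%:Z + 1) + W 2 x 1 b m).
Proof.
rewrite W_Bfst addrK -[W 1 x 2 b (m%:Z + 1)]mul1r -(expr0 'X).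
rewrite (@W_shift 1 x 1 b (m%:Z + 1) (m + 1) 0); last by lia.
rewrite -[W 1 x 2 b m]mul1r -(expr0 'X) (@W_shift 1 x 1 b m m 0); last by lia.
by rewrite mulrDr mulrA -exprS addn1.
Qed.

Section Crank_ge_rank.
Variable m : nat.

(** Up to a shift of degree, [t x] is what remains of slice x of C(r) - N(r), r = m + 1. [Phi] is a
    telescoping correction after which each step has one positive term, [T x], and one negative
    term. *)
Let t (x : nat) : {poly int} :=
  'X^(x + m + 1) * W 1 x 1 (x + m) m - 'X^(x + 1) * W 1 x 1 (x + m + 1) (m%:Z + 1).
Let Phi (x : nat) : {poly int} := 'X^(x + m + 2) * W 2 x 1 (x + m) m.
Let T (x : nat) : {poly int} := 'X^(x + x + m + 4) * W 1 x 2 (x + m) (m%:Z - 1).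

Let t0 : t 0 + Phi 0 = 'X^(m + 1) * W 2 0 1 m m.
Proof.
rewrite /t /Phi addn1 W_Bone (@W_gt _ _ _ _ (m%:Z + 1)); last by lia.
rewrite !add0n (_ : W 1 0 1 m m = W 2 0 1 m m) // !(addnS, addSn, addn0, add0n) !(exprS, exprD, expr0).
ring.
Qed.

Let tS x : t x.+1 + Phi x.+1 - Phi x
  = T x - 'X^(x + x + m + 5) * W 2 x 1 (x + m).+1 (m%:Z + 2).
Proof.
have E : T x = 'X^(x + x + m + m + 3) * W 2 x 1 (x + m) (m%:Z - 1).
  by apply: W_shift; lia.
rewrite E /t /Phi addn1 W_Bone W_Afst !addSn.
rewrite [W 2 x.+1 1 _ _]W_Alst [W 2 x.+1 1 _ m]W_Alst.
rewrite [W 2 x 1 (x + m).+1 m]W_Blst.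
rewrite (_ : m%:Z + 1 + 1 = m%:Z + 2); last by lia.
rewrite !(addnS, addSn, addn0, add0n) !(exprS, exprD, expr0); ring.
Qed.

(** Adding [T n] in advance compares the negative term of step n with [T n.+1] instead of [T n].
    This leaves a positive part, a summand of [residual_sum], and the last term, which half of the
    next negative term cancels. *)
Let crank_rank_sum n : exists2 P, pos P &
  \sum_(x < n.+1) t x + Phi n + T n
  = P + 'X^(m + 7) * residual_sum m n + 'X^(n + n + m + 5) * W 2 n 2 (n + m) (m%:Z + 2).
Proof.
elim: n => [|n [P hP IH]].
  exists ('X^(m + 1) * W 2 0 1 m m + T 0).
    by apply: posD; exact/posX/W_pos.
  rewrite big_ord_recr big_ord0 /= add0r t0 /residual_sum big_ord0 mulr0 addr0.
  by rewrite (@W_gt _ _ _ _ (m%:Z + 2)) ?mulr0 ?addr0 //; lia.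
(* The new part of the witness is a drop from exponent m - 1 to m + 1, positive by unimodality with
   [tau = 0]. *)
exists (P + 'X^(n + n + m + 6) * (W 2 n 2 (n + m + 1) (m%:Z - 1) - W 2 n 2 (n + m) (m%:Z + 1))).
  apply: posD => //; apply: posX.
  rewrite addn1 W_Blst addrAC; apply: posD; last exact/posX/W_pos.
  have := @W_qdec_B 2 0 n m (m%:Z - 1) (lexx _).
  by rewrite addn0 expr0 mul1r -addrA.
have E1 : t n.+1 = T n - 'X^(n + n + m + 5) * W 2 n 1 (n + m).+1 (m%:Z + 2) - Phi n.+1 + Phi n.
  by rewrite -tS; ring.
have E2 : T n.+1 = 'X^(n + n + m + 6) * W 2 n 2 (n + m + 1) (m%:Z - 1)
                   + 'X^(n + n + m + 7) * W 2 n 2 (n + m + 1) m.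
  rewrite /T W_Afst addSn subrK addn1; rewrite !(addnS, addSn, addn0, add0n) !(exprS, exprD, expr0); ring.
have E3 : W 2 n 1 (n + m).+1 (m%:Z + 2)
   = W 2 n 2 (n + m) (m%:Z + 2) + 'X * W 2 n 2 (n + m) (m%:Z + 1).
  by rewrite W_Bfst expr1 (_ : m%:Z + 2 - 1 = m%:Z + 1) //; lia.
have E4 : residual_sum m n.+1 = residual_sum m n
   + ('X^(n + n) * (W 2 n 2 (n + m + 1) m - W 2 n 2 (n + m + 1) (m%:Z + 2))
                - 'X^(n + n + n + 2) * W 2 n 2 (n + m + 1) (m%:Z + 3)).
  by rewrite /residual_sum big_ord_recr.
have E5 : W 2 n.+1 2 (n.+1 + m) (m%:Z + 2) = W 2 n 2 (n + m + 1) (m%:Z + 2)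
   + 'X^(n + 2) * W 2 n 2 (n + m + 1) (m%:Z + 3).
  rewrite (_ : n.+1 + m = n + m + 1)%N; last by lia.
  by rewrite W_Alst [(2 + n)%N]addnC (_ : m%:Z + 2 + 1 = m%:Z + 3) //; ring.
have {}IH : \sum_(x < n.+1) t x = P + 'X^(m + 7) * residual_sum m n
    + 'X^(n + n + m + 5) * W 2 n 2 (n + m) (m%:Z + 2) - T n - Phi n.
  by rewrite -IH; ring.
rewrite big_ord_recr /= IH E1 E2 E3 E4 E5.
rewrite !(addnS, addSn, addn0, add0n) !(exprS, exprD, expr0); ring.
Qed.

Lemma crank_rank_sum_ge0 n e : (e <= n)%N -> 0 <= (\sum_(x < n.+1) t x)`_e.
Proof.
move=> en; have [P hP E] := crank_rank_sum n.
have -> : \sum_(x < n.+1) t x = P + 'X^(m + 7) * residual_sum m n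
    + 'X^(n + n + m + 5) * W 2 n 2 (n + m) (m%:Z + 2) - T n - Phi n.
  by rewrite -E; ring.
rewrite /T /Phi !coefB !coefD ![ 'X^_ * _]mulrC !coefMXn.
rewrite (_ : e < n + n + m + 4)%N; last by lia.
rewrite (_ : e < n + m + 2)%N; last by lia.
rewrite (_ : e < n + n + m + 5)%N; last by lia.
rewrite /= !subr0 ?addr0 addr_ge0 ?hP //; case: ltnP => // em.
by apply: residual_sum_ge0; lia.
Qed.

End Crank_ge_rank.

Lemma W_leA sA a a' sB b d : (a <= a')%N -> pos (W sA a' sB b d - W sA a sB b d).
Proof.
move/subnKC <-; elim: (a' - a)%N => [|n IH]; first by rewrite addn0 subrr; exact: pos0.
by rewrite addnS W_Alst addrAC; apply/posD/posX/W_pos.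
Qed.

Lemma W_leB sA a sB b b' d : (b <= b')%N -> pos (W sA a sB b' d - W sA a sB b d).
Proof.
move/subnKC <-; elim: (b' - b)%N => [|n IH]; first by rewrite addn0 subrr; exact: pos0.
by rewrite addnS W_Blst addrAC; apply/posD/posX/W_pos.
Qed.

Lemma rank_crank_sum_ge0 m n e : (e <= n)%N ->
  0 <= (\sum_(x < n.+1)
     ('X^(x + 1) * W 1 x 1 (x + m + 2) (m%:Z + 1) - 'X^(x + m + 2) * W 1 x 1 (x + m + 1) m))`_e.
Proof.
move=> en.
pose f x : {poly int} :=
  'X^(x + 1) * W 1 x 1 (x + m + 2) (m%:Z + 1) - 'X^(x + m + 2) * W 1 x 1 (x + m + 1) m.
(* [N] carries the index shift: [N n] is invisible in degrees up to n, while [f n.+1 + N n.+1 - N n]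
   is a sum of increments of products under longer intervals. The length is [x.-1] because A ranges
   over 2, ..., x. *)
pose N x : {poly int} := 'X^(x + m + 3) * W 2 x.-1 1 (x + m + 1) (m%:Z + 1).
suff /(_ e) : pos (\sum_(x < n.+1) f x + N n).
  by rewrite coefD /N mulrC coefMXn (_ : e < n + m + 3)%N ?addr0 //; lia.
elim: n {e en} => [|n IH].
  rewrite big_ord1; apply: posD; last exact/posX/W_pos.
  rewrite /f [(_ + m + 2)%N]addnS W_Bone (_ : W 1 0 1 (0 + m + 1) m = W 2 0 1 (0 + m + 1) m) //.
  rewrite [X in pos X](_ : _ = 'X^(m + 2) * W 2 0 1 (0 + m + 1) (m%:Z + 1)).
    exact/posX/W_pos.
  rewrite !(addnS, addSn, addn0, add0n) !(exprS, exprD, expr0); ring.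
rewrite big_ord_recr /=.
have E : f n.+1 + N n.+1 - N n =
   'X^(n + m + 3) * (W 2 n.+1 1 (n + m + 2) (m%:Z + 1) - W 2 n.+1 1 (n + m + 1) (m%:Z + 1)
   + (W 2 n.+1 1 (n + m + 1) (m%:Z + 1) - W 2 n.-1 1 (n + m + 1) (m%:Z + 1))
   + (W 2 n.+1 1 (n + m + 2) m - W 2 n 1 (n + m + 2) m)).
  rewrite /f /N [(_ + m + 2)%N]addnS W_Bone [W 1 n.+1 1 _ m]W_Afst /= (_ : n.+1 + m + 1 = n + m + 2)%N; last by lia.
  rewrite !(addnS, addSn, addn0, add0n) !(exprS, exprD, expr0); ring.
have -> : \sum_(x < n.+1) f x + f n.+1 + N n.+1 = (\sum_(x < n.+1) f x + N n) + (f n.+1 + N n.+1 - N n).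
  by ring.
rewrite E; apply: posD => //; apply: posX.
by apply: posD; [apply: posD; [apply: W_leB|apply: W_leA]|apply: W_leA]; lia.
Qed.

Lemma W_coefA sA a a' sB b d e : (e < sA + a)%N -> (a <= a')%N ->
  (W sA a' sB b d)`_e = (W sA a sB b d)`_e.
Proof.
move=> he /subnKC <-; elim: (a' - a)%N => [|n IH]; first by rewrite addn0.
by rewrite addnS W_Alst coefD IH mulrC coefMXn (_ : e < sA + (a + n))%N ?addr0 //; lia.
Qed.

Lemma W_coefB sA a sB b b' d e : (e < sB + b)%N -> (b <= b')%N ->
  (W sA a sB b' d)`_e = (W sA a sB b d)`_e.
Proof.
move=> he /subnKC <-; elim: (b' - b)%N => [|n IH]; first by rewrite addn0.
by rewrite addnS W_Blst coefD IH mulrC coefMXn (_ : e < sB + (b + n))%N ?addr0 //; lia.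
Qed.

(* The coefficient of z^d q^e in the product over all i, j >= 1: factors of
   index larger than e do not contribute. *)
Definition Z (d : int) (e : nat) : int := (W 1 e 1 e d)`_e.

Lemma Z_coef a b d e : (e <= a)%N -> (e <= b)%N -> (W 1 a 1 b d)`_e = Z d e.
Proof. by move=> ha hb; rewrite (@W_coefA 1 e a) // (@W_coefB 1 e 1 e b). Qed.

(** * Gaussian binomial coefficients *)

(* Gaussian binomial coefficient [s + t choose s]. *)
Fixpoint qbin (s : nat) : nat -> {poly int} :=
  if s is s'.+1 then
    fix qbin_s (t : nat) := if t is t'.+1 then qbin s' t + 'X^(s'.+1) * qbin_s t' else 1
  else fun=> 1.

Lemma qbin0n t : qbin 0 t = 1. Proof. by []. Qed.
Lemma qbinn0 s : qbin s 0 = 1. Proof. by case: s. Qed.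
Lemma qbinSS s t : qbin s.+1 t.+1 = qbin s t.+1 + 'X^(s.+1) * qbin s.+1 t.
Proof. by []. Qed.

Lemma qbinSS' s t : qbin s.+1 t.+1 = qbin s.+1 t + 'X^(t.+1) * qbin s t.+1.
Proof.
elim: s t => [|s IHs] t.
  elim: t => [|t IHt]; first by rewrite qbinSS !qbin0n qbinn0.
  by rewrite qbinSS [in LHS]IHt [in RHS]qbinSS !qbin0n !exprS; ring.
elim: t => [|t IHt].
  by rewrite qbinSS [in LHS]IHs !qbinn0 [in RHS]qbinSS !exprS; ring.
rewrite qbinSS [in LHS]IHs [in LHS]IHt [in RHS]qbinSS [in RHS](qbinSS s t.+1).
rewrite !exprS; ring.
Qed.

Lemma qbinC s t : qbin s t = qbin t s.
Proof.
elim: s t => [|s IHs] t; first by rewrite qbinn0.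
by elim: t => [|t IHt] //; rewrite qbinSS qbinSS' IHs IHt.
Qed.

Lemma W_neg sA sB b (d : int) : d < 0 -> W sA 0 sB b d = 0.
Proof.
elim: b sB d => [|b IH] sB d h; first by rewrite W00; case: eqP => //; lia.
by rewrite W_Bfst !IH ?mulr0 ?addr0 //; lia.
Qed.

(** Since 1 + q^i / z = (q^i / z)(1 + z q^(-i)), the two index ranges join into one interval, and
    this is the q-binomial theorem. *)
Lemma W_qbin a b (d : nat) : (d <= b)%N ->
  W 0 a 1 b d = 'X^('C(d.+1, 2)) * qbin (b - d) (a + d).
Proof.
elim: a b d => [|a IH] b d hd.
  elim: b d hd => [|b IHb] d hd.
    by rewrite (_ : d = 0%N) ?W00 ?mulr1 //; lia.
  rewrite W_Blst; case: d hd => [|d] hd.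
    by rewrite (@W_neg _ _ _ (0 - 1)) // mulr0 addr0 IHb // !subn0 !qbinn0.
  rewrite (_ : d.+1%:Z - 1 = d%:Z); last by lia.
  rewrite (IHb d) //; have [bd|bd] := eqVneq b d.
    rewrite bd W_gt; last by lia.
    by rewrite !subnn !qbin0n mulr1 add0r mulr1 -exprD [in RHS]binS bin1; congr ('X^_); lia.
  rewrite IHb; last by lia.
  rewrite (_ : b.+1 - d.+1 = (b - d.+1).+1)%N; last by lia.
  rewrite (_ : b - d = (b - d.+1).+1)%N; last by lia.
  rewrite !add0n qbinSS mulrDr !mulrA -!exprD; congr (_ + 'X^_ * _).
  by rewrite [in RHS]binS bin1; lia.
rewrite W_Alst (IH b d) //; have [bd|bd] := eqVneq b d.
  rewrite bd W_gt; last by lia.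
  by rewrite subnn !qbin0n mulr0 addr0.
rewrite (_ : d%:Z + 1 = d.+1%:Z); last by lia.
rewrite IH; last by lia.
rewrite (_ : b - d = (b - d.+1).+1)%N; last by lia.
rewrite addSn qbinSS' mulrDr !mulrA -!exprD addnS; congr (_ + 'X^_ * _).
by rewrite [in LHS]binS bin1; lia.
Qed.

(* The summand of index a counts the partitions with largest part a + r + 1 and
   at most a + 1 parts. *)
Definition rank_ge_coef (r n : nat) : int :=
  \sum_(a < n.+1) ('X^(a + r + 1) * qbin (a + r + 1) a)`_n.

Lemma rank_ge_coef_trunc r n k : (n <= k)%N ->
  \sum_(a < k.+1) ('X^(a + r + 1) * qbin (a + r + 1) a)`_n = rank_ge_coef r n.
Proof.
move=> /subnKC <-; elim: (k - n)%N => [|i IH]; first by rewrite addn0.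
rewrite addnS big_ord_recr /= IH mulrC coefMXn (_ : n < _)%N ?addr0 //; lia.
Qed.

(** The bounds x on A and x + m on B grow together: a new pair has x + 1 in A or, failing that, x +
    m + 1 in B. The rank count is sliced by max A = x + 1 through [W_qbin], and its pairs with 0 in
    A cancel the crank pairs with x + 1 in A. *)
Lemma Z_staircase_rank_ge (m n : nat) (e := (n + 'C(m.+1, 2))%N) :
  Z m.+1 e = rank_ge_coef m.+1 n + (\sum_(x < e.+1)
   ('X^(x + m + 1) * W 1 x 1 (x + m) m - 'X^(x + 1) * W 1 x 1 (x + m + 1) (m%:Z + 1)))`_e.
Proof.
rewrite -(rank_ge_coef_trunc m.+1 (leq_addr 'C(m.+1, 2) n)) -/e.
rewrite -(@Z_coef e.+1 (e.+1 + m) m.+1 e); try lia.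
have -> : W 1 e.+1 1 (e.+1 + m) m.+1 = \sum_(x < e.+1)
  ('X^(x + m + 1) * W 1 x 1 (x + m) m + 'X^(x + 1) * W 1 x 1 (x + m + 1) (m%:Z + 2)).
  elim: e.+1 => [|k IH]; first by rewrite big_ord0 W_gt //; lia.
  rewrite big_ord_recr /= -IH W_Alst addSn W_Blst.
  rewrite (_ : m.+1%:Z + 1 = m%:Z + 2); last by lia.
  rewrite (_ : m.+1%:Z - 1 = m%:Z); last by lia.
  have e1 : (1 + (k + m) = k + m + 1)%N by lia.
  have e2 : (1 + k = k + 1)%N by lia.
  by rewrite e1 e2 -[(k + m).+1]addn1 -addrA.
have -> : \sum_(a < e.+1) ('X^(a + m.+1 + 1) * qbin (a + m.+1 + 1) a)`_n =
  (\sum_(x < e.+1) 'X^(x + 1) * (W 1 x 1 (x + m + 1) (m%:Z + 1) + W 1 x 1 (x + m + 1) (m%:Z + 2)))`_e.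
  rewrite coef_sum; apply: eq_bigr => x _.
  have -> : W 1 x 1 (x + m + 1) (m%:Z + 1) + W 1 x 1 (x + m + 1) (m%:Z + 2)
    = W 0 x.+1 1 (x + m + 1) m.+1.
    by rewrite W_Afst mul1r; congr (W _ _ _ _ _ + W _ _ _ _ _); lia.
  rewrite W_qbin; last by lia.
  rewrite mulrA -exprD ![ 'X^_ * _]mulrC !coefMXn qbinC /e.
  rewrite (_ : x + m + 1 - m.+1 = x)%N; last by lia.
  rewrite (_ : x.+1 + m.+1 = x + m.+1 + 1)%N; last by lia.
  rewrite (_ : x + 1 + 'C(m.+2, 2) = x + m.+1 + 1 + 'C(m.+1, 2))%N; last by rewrite binS bin1; lia.
  by rewrite ltn_add2r subnDr qbinC.
rewrite -coefD -big_split /=; congr (polyseq _)`_e; apply: eq_bigr => x _; ring.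
Qed.

Lemma crank_ge_rank m n : rank_ge_coef m.+1 n <= Z m.+1 (n + 'C(m.+1, 2))%N.
Proof. by rewrite Z_staircase_rank_ge lerDl crank_rank_sum_ge0. Qed.

(** The same slicing with bounds x and x + m + 1. The rank sum has one slice more than there are
    increments, since its slice [a = 0] is the starting product. *)
Lemma rank_ge_crank m n : Z m.+1 (n + 'C(m.+1, 2))%N <= rank_ge_coef m n.
Proof.
set e := (n + _)%N.
rewrite -(rank_ge_coef_trunc m (k := e.+1)); last by rewrite /e; lia.
rewrite -(@Z_coef e.+1 (e.+1 + m + 1) m.+1 e); try lia.
pose f x : {poly int} :=
  'X^(x + 1) * W 1 x 1 (x + m + 2) (m%:Z + 1) - 'X^(x + m + 2) * W 1 x 1 (x + m + 1) m.
suff -> : \sum_(a < e.+2) ('X^(a + m + 1) * qbin (a + m + 1) a)`_n =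
    (W 1 e.+1 1 (e.+1 + m + 1) m.+1 + \sum_(x < e.+1) f x)`_e.
  by rewrite coefD lerDl rank_crank_sum_ge0.
have -> : \sum_(a < e.+2) ('X^(a + m + 1) * qbin (a + m + 1) a)`_n =
  (\sum_(a < e.+2) 'X^a * W 0 a 1 (a + m + 1) m.+1)`_e.
  rewrite coef_sum; apply: eq_bigr => a _.
  rewrite W_qbin; last by lia.
  rewrite mulrA -exprD ![ 'X^_ * _]mulrC !coefMXn qbinC /e.
  rewrite (_ : a + m + 1 - m.+1 = a)%N; last by lia.
  rewrite (_ : a + m.+1 = a + m + 1)%N; last by lia.
  rewrite (_ : a + 'C(m.+2, 2) = a + m + 1 + 'C(m.+1, 2))%N; last by rewrite binS bin1; lia.
  by rewrite ltn_add2r subnDr qbinC.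
congr (polyseq _)`_e; elim: e.+1 => [|k IH].
  by rewrite big_ord1 big_ord0 addr0 expr0 mul1r.
rewrite big_ord_recr /= IH [in RHS]big_ord_recr /= W_Afst expr0 mul1r W_Alst.
rewrite (_ : k.+1 + m + 1 = (k + m + 1).+1)%N; last by lia.
rewrite [W 1 k 1 _.+1 m.+1 in RHS]W_Blst /f.
rewrite (_ : (k + m + 1).+1 = k + m + 2)%N; last by lia.
rewrite (_ : m.+1%:Z - 1 = m%:Z); last by lia.
rewrite (_ : m.+1%:Z = m%:Z + 1); last by lia.
rewrite (_ : m%:Z + 1 + 1 = m%:Z + 2); last by lia.
rewrite !(addnS, addSn, addn0, add0n) !(exprS, exprD, expr0); ring.
Qed.

(** * Enumeration of partitions *)

(* The argument [f] is fuel. *)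
Fixpoint parts_le (f s n : nat) : seq (seq nat) :=
  if f is f'.+1 then
    if s is s'.+1 then
      parts_le f' s' n ++
      (if (s <= n)%N then map (cons s) (parts_le f' s (n - s)) else [::])
    else if n == 0%N then [:: [::]] else [::]
  else [::].

Lemma sorted_geq_cons x l : sorted geq (x :: l) = all (fun y => y <= x)%N l && sorted geq l.
Proof.
by rewrite /= path_sortedE // => a b c /= h1 h2; apply: leq_trans h2 h1.
Qed.

Lemma mem_parts_le f s n l : (s + n < f)%N ->
  (l \in parts_le f s n) = is_partition n l && all (fun x => x <= s)%N l.
Proof.
rewrite /is_partition.
elim: f s n l => [|f IH] s n l // hf; case: s hf => [|s] hf.
  rewrite /=; case: l => [|x l] /=; last first.
    have -> : ((x :: l) \in (if n == 0%N then [:: [::]] else [::])) = false by case: eqP.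
    by case: x => [|x]; rewrite ?andbF.
  by rewrite eq_sym; case: eqP.
rewrite [parts_le _ _ _]/= mem_cat IH; last by lia.
case: l => [|x l].
  by rewrite /= !andbT orbC; case: ifP => // _; case: mapP => // -[].
have -> : (x :: l \in (if (s < n)%N then [seq s.+1 :: i | i <- parts_le f s.+1 (n - s.+1)] else [::]))
   = [&& x == s.+1, (s < n)%N & l \in parts_le f s.+1 (n - s.+1)].
  case: ifP => sn; last by rewrite andbF.
  have [->|xs] /= := eqVneq x s.+1; first by rewrite mem_map // => a b [].
  by apply/negP => /mapP [y _ [/eqP]]; rewrite (negPf xs).
have [->|xs] := eqVneq x s.+1.
  rewrite sorted_geq_cons /= ltnn andbF /=.
  have [sn|sn] := ltnP s n; last first.
    by rewrite (_ : (_ == n) = false) ?andbF //; apply/eqP; lia.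
  rewrite IH; last by lia.
  rewrite leqnn /= (_ : (sumn l == n - s.+1)%N = (s.+1 + sumn l == n)%N); last by lia.
  by case: (all (fun y => y <= s.+1)%N l); rewrite ?andbT ?andbF.
rewrite orbF sorted_geq_cons /=.
have [xl|xl] := leqP x s.
  rewrite (_ : (x <= s.+1)%N = true) /=; last by lia.
  case: (boolP (all _ l)) => //= ha.
  rewrite (_ : all (fun x => x <= s)%N l = true); last by apply: sub_all ha => y /=; lia.
  by rewrite (_ : all (fun x => x <= s.+1)%N l = true) //; apply: sub_all ha => y /=; lia.
by rewrite (_ : (x <= s.+1)%N = false) ?andbF //; apply/negP; move/eqP: xs; lia.
Qed.

Lemma parts_le_uniq f s n : (s + n < f)%N -> uniq (parts_le f s n).
Proof.
elim: f s n => [|f IH] s n // hf; case: s hf => [|s] hf; first by rewrite /=; case: eqP.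
rewrite [parts_le _ _ _]/= cat_uniq IH /=; last by lia.
case: ifP => sn //; apply/andP; split; last first.
  by rewrite map_inj_uniq ?IH //; [lia|move=> a b []].
apply/hasPn => l /mapP [y _ ->]; rewrite mem_parts_le; last by lia.
by rewrite /= ltnn !andbF.
Qed.

Lemma count_parts_leS P f s n : count P (parts_le f.+1 s.+1 n) =
  (count P (parts_le f s n) +
   (if s < n then count (fun l => P (s.+1 :: l)) (parts_le f s.+1 (n - s.+1)) else 0))%N.
Proof. by rewrite [parts_le _ _ _]/= count_cat; case: ifP; rewrite // count_map. Qed.

Lemma count_parts_le0 P f n : count P (parts_le f.+1 0 n) = ((n == 0%N) && P [::] : nat).
Proof. by rewrite /=; case: eqP => //=; rewrite addn0. Qed.

Lemma count_box f s t n : (s + n < f)%N ->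
  (count (fun l => size l <= t)%N (parts_le f s n))%:Z = (qbin s t)`_n.
Proof.
elim: f s t n => [|f IH] s t n // hf; case: s hf => [|s] hf.
  by rewrite count_parts_le0 qbin0n coef1 andbT; case: eqP.
rewrite count_parts_leS PoszD IH; last by lia.
case: t => [|t]; first by rewrite qbinn0 [count _ _]count_pred0 if_same addr0 qbinn0.
rewrite qbinSS coefD coefXnM ltnS; congr (_ + _); case: ltnP => // sn.
by rewrite -IH //; lia.
Qed.

Lemma parts_le1 f n : (n + 1 < f)%N -> parts_le f 1 n = [:: nseq n 1%N].
Proof.
elim: f n => [|f IH] [|n] // hf; first by case: f {IH} hf.
have E0 : parts_le f 0 n.+1 = [::] by case: f {IH hf}.
have E1 : parts_le f.+1 1 n.+1 = parts_le f 0 n.+1 ++ map (cons 1%N) (parts_le f 1 (n.+1 - 1)) by [].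
rewrite E1 E0 subn1 IH; last by lia.
by [].
Qed.

Lemma qbin1_geom T : (1 - 'X) * qbin 1 T = 1 - 'X^(T.+1).
Proof.
elim: T => [|T IH]; first by rewrite qbinn0 mulr1 expr1.
rewrite qbinSS qbin0n mulrDr mulr1 mulrCA IH !exprS; ring.
Qed.

(** For [n <= T], [qbin s T] agrees in degree n with 1 / (q)_s. The factor [1 - 'X] removes the
    parts equal to 1 and ['X^w] puts back w of them. *)
Lemma count_num_ones f s (w : nat) n T : (0 < s)%N -> (s + n < f)%N -> (n <= T)%N ->
  (count (fun l => num_ones l == w) (parts_le f s n))%:Z = ('X^w * ((1 - 'X) * qbin s T))`_n.
Proof.
elim: f s n T => [|f IH] s n T // s0 hf nT; case: s s0 hf => [|s] // _ hf.
have [->|s0] := posnP s.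
  rewrite parts_le1; last by lia.
  rewrite /= /num_ones count_nseq /= mul1n addn0 qbin1_geom mulrBr mulr1 -exprD coefB !coefXn.
  rewrite (_ : (n == w + T.+1)%N = false) ?subr0; last by apply/eqP; lia.
  by case: eqP.
rewrite count_parts_leS PoszD (IH s n T) //.
case: T nT => [|T] nT.
  have -> : n = 0%N by lia.
  by rewrite /= addr0 !qbinn0.
rewrite qbinSS !mulrDr coefD; congr (_ + _).
rewrite [in RHS]mulrA [in RHS]mulrA [_ * 'X^(s.+1)]mulrC -!mulrA coefXnM ltnS.
case: ltnP => // sn; rewrite -IH //; try lia.
by congr (Posz _); apply: eq_count => l; rewrite /num_ones /= eqSS (gtn_eqF s0).
Qed.

(** The t parts above w, each lowered by w + 1, fit in a u by t box; the other parts form a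
    partition with w ones and parts at most w. *)
Lemma count_crank_class f (w u t : nat) n T : (0 < w)%N -> (w + u.+1 + n < f)%N -> (n <= T)%N ->
  (count (fun l => (num_ones l == w) && (count (fun x => w < x)%N l == t)) (parts_le f (w + u.+1) n))%:Z
  = ('X^(w.+1 * t) * qbin u t * ('X^w * ((1 - 'X) * qbin w T)))`_n.
Proof.
move=> w0; elim: f u t n T => [|f IH] u t n T // hf nT.
have base : (count (fun l => (num_ones l == w) && (count (fun x => w < x)%N l == 0%N)) (parts_le f w n))%:Z
  = ('X^w * ((1 - 'X) * qbin w T))`_n.
  rewrite -(@count_num_ones f w w n T) //; last by lia.
  congr (Posz _); apply: eq_in_count => l; rewrite mem_parts_le; last by lia.
  case/andP=> _ h; rewrite (_ : count _ _ = 0%N) ?andbT //.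
  by rewrite (eq_in_count (a2 := pred0)) ?count_pred0 // => x /(allP h) xw; rewrite ltnNge xw.
have baseS t' : (count (fun l => (num_ones l == w) && (count (fun x => w < x)%N l == t'.+1)) (parts_le f w n)) = 0%N.
  rewrite (eq_in_count (a2 := pred0)) ?count_pred0 // => l; rewrite mem_parts_le; last by lia.
  case/andP=> _ h; rewrite (_ : count _ _ = 0%N) ?andbF //.
  by rewrite (eq_in_count (a2 := pred0)) ?count_pred0 // => x /(allP h) xw; rewrite ltnNge xw.
rewrite addnS count_parts_leS PoszD.
have E l : (num_ones ((w + u).+1 :: l) == w) && (count (fun x => w < x)%N ((w + u).+1 :: l) == t)
  = (0 < t)%N && ((num_ones l == w) && (count (fun x => w < x)%N l == t.-1)).
  rewrite /num_ones /= eqSS (_ : (w + u == 0)%N = false); last by apply/eqP; lia.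
  by rewrite ltnS leq_addr add1n add0n; case: t => [|t]; rewrite ?andbF.
rewrite (eq_count E); case: t {E} => [|t] /=.
  rewrite count_pred0 if_same addr0 muln0 mul1r qbinn0 mul1r.
  by case: u hf => [|u] hf; [rewrite addn0 base|rewrite (IH u 0%N n T) ?muln0 ?mul1r ?qbinn0 ?mul1r //; lia].
have E2 : (if (w + u < n)%N then count (fun l => (num_ones l == w) && (count (fun x => w < x)%N l == t)) (parts_le f (w + u).+1 (n - (w + u).+1)) else 0%N)%:Z
   = ('X^((w + u).+1) * ('X^(w.+1 * t) * qbin u t * ('X^w * ((1 - 'X) * qbin w T))))`_n.
  rewrite coefXnM ltnS; case: ltnP => // wn.
  by rewrite -addnS (IH u t _ T) //; lia.
rewrite E2; case: u hf {E2} => [|u] hf.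
  rewrite addn0 baseS add0r; congr (polyseq _)`_n.
  by rewrite mulnS !(exprS, exprD) !qbin0n; ring.
rewrite (IH u t.+1 n T) //; last by lia.
rewrite -coefD; congr (polyseq _)`_n.
by rewrite qbinSS mulnS !(addSn, addnS) !(exprS, exprD); ring.
Qed.

(** * The crank generating function *)

(* Elementary symmetric function of degree j in q^s, ..., q^(s + a - 1). *)
Definition elsym (s a j : nat) : {poly int} :=
  if (j <= a)%N then 'X^('C(j, 2) + s * j) * qbin j (a - j) else 0.

Lemma elsym0 s a : elsym s a 0 = 1.
Proof. by rewrite /elsym leq0n muln0 addn0 qbin0n mulr1. Qed.

Lemma elsymS s a j : elsym s a.+1 j.+1 = elsym s a j.+1 + 'X^(s + a) * elsym s a j.
Proof.
rewrite /elsym ltnS; case: ltngtP => [ja|ja|->]; first 1 last.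
- by rewrite mulr0 addr0.
- rewrite add0r !subnn !qbinn0 !mulr1 -exprD binS bin1; congr ('X^_); lia.
rewrite (_ : a.+1 - j.+1 = (a - j.+1).+1)%N; last by lia.
rewrite (_ : a - j = (a - j.+1).+1)%N; last by lia.
rewrite qbinSS' mulrDr !mulrA -!exprD; congr (_ + 'X^_ * _).
by rewrite binS bin1; lia.
Qed.

Lemma W_elsymB sA sB b (t : nat) : W sA 0 sB b t = elsym sB b t.
Proof.
elim: b t => [|b IH] [|t] //.
- by rewrite elsym0.
- by rewrite W_Blst IH (@W_neg _ _ _ (0 - 1)) // mulr0 addr0 !elsym0.
by rewrite W_Blst elsymS IH (_ : t.+1%:Z - 1 = t) ?IH //; lia.
Qed.

Lemma W_elsym sA a sB b (d : nat) :
  W sA a sB b d = \sum_(j < a.+1) elsym sA a j * elsym sB b (d + j).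
Proof.
elim: a d => [|a IH] d; first by rewrite big_ord1 elsym0 mul1r addn0 W_elsymB.
rewrite W_Alst IH (_ : d%:Z + 1 = d.+1%:Z); last by lia.
rewrite IH [in RHS]big_ord_recl elsym0 mul1r addn0.
under [in RHS]eq_bigr do rewrite /= /bump /= add1n elsymS mulrDl.
rewrite big_split addrA; congr (_ + _); last first.
  by rewrite big_distrr; apply: eq_bigr => j _ /=; rewrite mulrA addSnnS.
rewrite big_ord_recl elsym0 mul1r addn0; congr (_ + _).
rewrite big_ord_recr /= [X in _ = _ + X](_ : _ = 0) ?addr0.
  by apply: eq_bigr => j _; rewrite /bump add1n.
by rewrite /elsym ltnn mul0r.
Qed.

Lemma elsym_factor s a j : exists q, elsym s a j = 'X^('C(j, 2) + s * j) * q.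
Proof. by rewrite /elsym; case: ifP => _; [exists (qbin j (a - j))|exists 0; rewrite mulr0]. Qed.

(** At least d elements lie in B, and their sum is at least 1 + ... + d. This ends the telescoping
    over cranks. *)
Lemma Z_eq0 (d e : nat) : (e < 'C(d.+1, 2))%N -> Z d e = 0.
Proof.
move=> he; rewrite /Z W_elsym coef_sum big1 // => j _.
have [q ->] := elsym_factor 1 e (d + j).
rewrite mulrCA coefXnM ifT //; apply: (leq_trans he).
rewrite mul1n (_ : 'C(d + j, 2) + (d + j) = 'C((d + j).+1, 2))%N; last by rewrite binS bin1.
by apply: leq_bin2l; lia.
Qed.

Lemma double_bin2 k : (2 * 'C(k, 2) + k = k * k)%N.
Proof. by elim: k => // k IH; rewrite binS bin1; lia. Qed.

(* Number of partitions of n with w ones and t parts larger than w, for w > 0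
   and M large.
   For w = 0 the same expression counts the partitions without ones with largest
   part t.  It is symmetric in w and t. *)
Definition crank_term (M n w t : nat) : int :=
  ((1 - 'X) * ('X^(w + w.+1 * t) * (qbin t (M - t) * qbin w (M - w))))`_n.

Lemma crank_term_sum M n m : (n + n + m <= M)%N -> (n + 'C(m.+1, 2) <= M)%N ->
  \sum_(w < n.+1) crank_term M n w (w + m) = Z m (n + 'C(m, 2)) - Z m.+1 (n + 'C(m.+1, 2)).
Proof.
move=> hM hM2; set E := (n + 'C(m.+1, 2))%N.
have expo w : ('C(w, 2) + 1 * w + ('C(m + w, 2) + 2 * (m + w))
   = w + w.+1 * (w + m) + 'C(m.+1, 2))%N.
  have := double_bin2 w; have := double_bin2 (m + w); have := double_bin2 m.+1; nia.
have term w : (w <= n)%N -> crank_term M n w (w + m)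
    = ((1 - 'X) * (elsym 1 M w * elsym 2 M (m + w)))`_E.
  move=> wn; rewrite /elsym !ifT; try lia.
  rewrite mulrACA -exprD expo exprD.
  transitivity (('X^('C(m.+1, 2)) * ((1 - 'X) * ('X^(w + w.+1 * (w + m)) *
      (qbin (w + m) (M - (w + m)) * qbin w (M - w)))) : {poly int})`_E).
    by rewrite coefXnM ltnNge leq_addl /= addnK.
  congr (polyseq _)`_E; rewrite [(m + w)%N]addnC; ring.
have -> : \sum_(w < n.+1) crank_term M n w (w + m) = ((1 - 'X) * W 1 M 2 M m)`_E.
  rewrite W_elsym mulr_sumr coef_sum (big_ord_widen M.+1 (fun w => crank_term M n w (w + m))%N); last by lia.
  rewrite big_mkcond; apply: eq_bigr => w _; case: ifP => wn; first by rewrite term.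
  have [p ->] := elsym_factor 1 M w; have [q ->] := elsym_factor 2 M (m + w).
  rewrite mulrACA -exprD expo [_ * (p * q)]mulrC mulrA mulrC coefXnM ifT //.
  by move: wn; rewrite /E; nia.
(* Both products on the right are expanded along their factor of index 1; after z is rescaled by q
   their terms of exponent m + 1 cancel. *)
have -> : (1 - 'X) * W 1 M 2 M m = 'X^m * W 1 M.+1 1 M m - W 1 M 1 M.+1 m.+1.
  rewrite W_Afst W_Bfst expr1 mulrDr mulrA -exprSr.
  have := @W_shift 1 M 1 M m m 0; rewrite expr0 mul1r addr0 => <- //.
  have := @W_shift 1 M 1 M m.+1 m.+1 0; rewrite expr0 mul1r addr0 => /(_ erefl).
  rewrite (_ : m.+1%:Z = m%:Z + 1); last by lia.
  by rewrite addrK => <-; ring.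
rewrite coefB coefXnM (@Z_coef M M.+1 _ E) //; last by lia.
rewrite ifF; last by apply/negbTE; rewrite -leqNgt /E binS bin1; lia.
have e1 : (E - m = n + 'C(m, 2))%N by rewrite /E binS bin1; lia.
by rewrite e1 Z_coef //; move: hM2; rewrite binS bin1; lia.
Qed.

Lemma crank_termC M n w t : crank_term M n w t = crank_term M n t w.
Proof.
rewrite /crank_term (_ : w + w.+1 * t = t + t.+1 * w)%N; last by nia.
by rewrite [_ * qbin w _]mulrC.
Qed.

(** * Counting partitions by rank and by crank *)

Lemma largest_part_le l s : (largest_part l <= s)%N = all (fun x => x <= s)%N l.
Proof. by elim: l => //= x l IH; rewrite geq_max IH. Qed.

Lemma partition_largest_le n l : is_partition n l -> (largest_part l <= n)%N.
Proof.
case/and3P=> _ _ /eqP <-; rewrite largest_part_le; elim: l => //= x l IH.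
by rewrite leq_addr; apply: sub_all IH => y /leq_trans; apply; exact: leq_addl.
Qed.

Lemma partition_size_le n l : is_partition n l -> (size l <= n)%N.
Proof.
by case/and3P=> _ + /eqP <-; elim: l => //= x l IH /andP [x0 /IH]; lia.
Qed.

Lemma partition_nil n l : (0 < n)%N -> is_partition n l -> (0 < size l)%N.
Proof. by case: l => //= n0 /and3P [_ _ /eqP /= E]; rewrite -E in n0. Qed.

Lemma partition_largest_gt0 n l : (0 < n)%N -> is_partition n l -> (0 < largest_part l)%N.
Proof.
by case: l => [|x l] n0 /and3P [_] //=; [move=> _ /eqP E; rewrite -E in n0|case/andP; lia].
Qed.

Lemma count_sum (P : pred (seq nat)) (v : seq nat -> nat) (Q : nat -> pred (seq nat)) K L :
  {in L, forall l, P l -> (v l < K)%N} ->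
  {in L, forall l a, (a < K)%N -> Q a l = P l && (v l == a)} ->
  count P L = (\sum_(a < K) count (Q a) L)%N.
Proof.
move=> hv hQ; rewrite -sum1_count big_mkcond /=.
under [RHS]eq_bigr do rewrite -sum1_count big_mkcond /=.
rewrite exchange_big /= !big_seq; apply: eq_bigr => l lL.
under eq_bigr => a _ do rewrite hQ //.
case: ifP => Pl; last by rewrite big1.
rewrite (bigD1 (Ordinal (hv l lL Pl))) //= eqxx big1 // => a ha.
by rewrite ifF //; apply/negbTE; apply: contraNneq ha => E; apply/eqP/val_inj; rewrite /= E.
Qed.

Lemma count_splitD (P P1 P2 : pred (seq nat)) L :
  (forall l, (P l = P1 l + P2 l :> nat)%N) -> count P L = (count P1 L + count P2 L)%N.
Proof. by move=> h; elim: L => //= l L ->; rewrite h addnACA. Qed.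

Section Counts.
Variables (n : nat) (L : seq (seq nat)).
Hypothesis (n0 : (0 < n)%N) (LP : enum_partitions n L).

Let partL l : l \in L -> is_partition n l.
Proof. by rewrite LP.2. Qed.

Lemma count_largest_le s Q :
  count (fun l => (largest_part l <= s)%N && Q l) L = count Q (parts_le (s + n).+1 s n).
Proof.
transitivity (count Q (filter (fun l => largest_part l <= s)%N L)).
  by rewrite count_filter; apply: eq_count => l /=; rewrite andbC.
apply/permP: Q; apply: uniq_perm; first exact/filter_uniq/LP.1.
  exact: parts_le_uniq.
by move=> l; rewrite mem_filter LP.2 mem_parts_le // andbC largest_part_le.
Qed.

Lemma count_enum s Q : (n <= s)%N -> count Q L = count Q (parts_le (s + n).+1 s n).
Proof.
move=> ns; rewrite -count_largest_le; apply: eq_in_count => l /partL /partition_largest_le h.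
by rewrite (leq_trans h ns).
Qed.

Lemma count_box_enum s t :
  (count (fun l => (largest_part l <= s) && (size l <= t))%N L)%:Z = (qbin s t)`_n.
Proof. by rewrite count_largest_le count_box. Qed.

Lemma count_largest_eq s t :
  (count (fun l => (largest_part l == s.+1) && (size l <= t.+1))%N L)%:Z
  = ('X^(s.+1) * qbin s.+1 t)`_n.
Proof.
have := count_box_enum s.+1 t.+1; rewrite qbinSS coefD -count_box_enum.
rewrite (@count_splitD _ (fun l => (largest_part l <= s) && (size l <= t.+1))%N
          (fun l => (largest_part l == s.+1) && (size l <= t.+1))%N); first by lia.
by move=> l; case: (size l <= _)%N; rewrite ?andbT ?andbF //; lia.
Qed.

Lemma count_size_eq s t :
  (count (fun l => (size l == t.+1) && (largest_part l <= s.+1))%N L)%:Z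
  = ('X^(t.+1) * qbin t.+1 s)`_n.
Proof.
have := count_box_enum s.+1 t.+1; rewrite qbinSS' coefD -count_box_enum [qbin s _]qbinC.
rewrite (@count_splitD _ (fun l => (largest_part l <= s.+1) && (size l <= t))%N
          (fun l => (size l == t.+1) && (largest_part l <= s.+1))%N); first by lia.
by move=> l; case: (largest_part l <= _)%N; rewrite ?andbT ?andbF //; lia.
Qed.

Lemma count_rank_ge (r : nat) : (count (fun l => r%:Z <= prank l) L)%:Z = rank_ge_coef r n.
Proof.
(* The truncated subtraction is exact: a nonempty partition of rank at least r has largest part at
   least r + 1. *)
rewrite (@count_sum _ (fun l => largest_part l - r.+1)%N
  (fun a l => (largest_part l == (a + r).+1) && (size l <= a.+1))%N n.+1).
- rewrite (big_morph Posz PoszD (erefl _)); apply: eq_bigr => a _.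
  by rewrite count_largest_eq addn1.
- by move=> l /partL /partition_largest_le; lia.
move=> l /partL /(partition_nil n0) h a an; rewrite /prank; lia.
Qed.

Lemma count_rank_le (r : nat) : (count (fun l => prank l <= - r%:Z) L)%:Z = rank_ge_coef r n.
Proof.
rewrite (@count_sum _ (fun l => size l - r.+1)%N
  (fun a l => (size l == (a + r).+1) && (largest_part l <= a.+1))%N n.+1).
- rewrite (big_morph Posz PoszD (erefl _)); apply: eq_bigr => a _.
  by rewrite count_size_eq addn1.
- by move=> l /partL /partition_size_le; lia.
move=> l /partL /(partition_largest_gt0 n0) h a an; rewrite /prank; lia.
Qed.

Lemma count_crank_neg (w t M : nat) : (0 < w)%N -> (n + n + t + w <= M)%N ->
  (count (fun l => (num_ones l == w) && (count (fun x => w < x)%N l == t)) L)%:Z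
  = crank_term M n w t.
Proof.
move=> w0 hM; rewrite (@count_enum (w + (M - t).+1)); last by lia.
rewrite (@count_crank_class _ w (M - t) t n (M - w)) //; last by lia.
congr (polyseq _)`_n; rewrite exprD [qbin t _]qbinC; ring.
Qed.

Hypothesis n1 : (1 < n)%N.

(** Subtract the counts for largest part at most m and at most m - 1. For [m = 1] the smaller bound
    is 0, outside the range of [count_num_ones]; both sides are then 0 because n > 1. *)
Lemma count_crank_zero (m M : nat) : (0 < m)%N -> (n + n + m <= M)%N ->
  (count (fun l => (num_ones l == 0%N) && (largest_part l == m)) L)%:Z = crank_term M n 0 m.
Proof.
have cnt s T : (0 < s)%N -> (n <= T)%N ->
    (count (fun l => (largest_part l <= s)%N && (num_ones l == 0%N)) L)%:Z = ((1 - 'X) * qbin s T)`_n.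
  move=> s0 nT; rewrite count_largest_le (@count_num_ones _ s 0 n T) //.
  by rewrite expr0 mul1r.
case: m => // m _ hM; have [m0|m0] := posnP m.
  have c1 : (count (fun l => (largest_part l <= 1)%N && (num_ones l == 0%N)) L)%:Z = 0.
    by rewrite (cnt 1%N n) // qbin1_geom coefB coef1 coefXn; case: eqP; [lia|case: eqP; lia].
  rewrite m0 /crank_term add0n mul1n subn0 qbin0n mulr1 mulrCA qbin1_geom mulrBr mulr1.
  rewrite -exprD coefB !coefXn.
  case: eqP => [|_]; first by lia.
  case: eqP => [|_]; first by lia.
  suff : (count (fun l => (num_ones l == 0%N) && (largest_part l == 1%N)) L
          <= count (fun l => (largest_part l <= 1)%N && (num_ones l == 0%N)) L)%N by lia.
  by apply: sub_count => l /andP [-> /eqP ->].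
have nM : (n <= (M - m.+1).+1)%N by lia.
have h1 := cnt m _ m0 nM; have := cnt m.+1 _ isT nM.
rewrite (@count_splitD (fun l => (largest_part l <= m.+1)%N && (num_ones l == 0%N))
   (fun l => (largest_part l <= m)%N && (num_ones l == 0%N))
   (fun l => (num_ones l == 0%N) && (largest_part l == m.+1))); last first.
  by move=> l; case: (num_ones l == _); rewrite ?andbT ?andbF //; lia.
rewrite PoszD h1 qbinSS mulrDr coefD => /addrI ->.
by rewrite /crank_term add0n mul1n qbin0n mulr1 mulrCA.
Qed.

Lemma count_ones_le l : is_partition n l -> (num_ones l <= n)%N.
Proof. by move/partition_size_le; apply: leq_trans; exact: count_size. Qed.

Lemma count_crank_pos_eq (m : nat) : (0 < m)%N ->
  (count (fun l => pcrank l == m%:Z) L)%:Z = Z m (n + 'C(m, 2)) - Z m.+1 (n + 'C(m.+1, 2)).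
Proof.
move=> m0; pose M := (n + n + n + m + n + 'C(m.+1, 2))%N.
rewrite -(@crank_term_sum M) /M; try lia.
rewrite -/M (@count_sum _ num_ones (fun w l => (num_ones l == w) &&
  (if w == 0%N then largest_part l == m else count (fun x => w < x)%N l == w + m)%N) n.+1).
- rewrite (big_morph Posz PoszD (erefl _)); apply: eq_bigr => w _.
  have [->|w0] := posnP w; first by rewrite (count_crank_zero (M := M)) //; rewrite /M; lia.
  by rewrite (count_crank_neg (M := M)) // /M; have := ltn_ord w; lia.
- by move=> l /partL /count_ones_le; lia.
move=> l _ w wn; rewrite /pcrank andbC; have [->|] := eqVneq w (num_ones l); last by rewrite !andbF.
by rewrite !andbT; case: eqP => _; lia.
Qed.

(** Crank -m means t larger parts and t + m ones; [crank_termC] identifies these classes with those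
    of crank m. *)
Lemma count_crank_neg_eq (m : nat) : (0 < m)%N ->
  (count (fun l => pcrank l == - m%:Z) L)%:Z = Z m (n + 'C(m, 2)) - Z m.+1 (n + 'C(m.+1, 2)).
Proof.
move=> m0; pose M := (n + n + n + m + n + 'C(m.+1, 2))%N.
rewrite -(@crank_term_sum M) /M; try lia.
rewrite -/M (@count_sum _ (fun l => count (fun x => num_ones l < x)%N l)
  (fun t l => (num_ones l == t + m)%N && (count (fun x => t + m < x)%N l == t)) n.+1).
- rewrite (big_morph Posz PoszD (erefl _)); apply: eq_bigr => t _.
  by rewrite crank_termC (count_crank_neg (M := M)) // /M; have := ltn_ord t; lia.
- by move=> l /partL /partition_size_le h _; rewrite ltnS (leq_trans (count_size _ _) h).
move=> l lL t tn; rewrite /pcrank.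
have [E|E] := eqVneq (num_ones l) (t + m)%N.
  rewrite -E (_ : (num_ones l == 0%N) = false) /=; last by apply/eqP; lia.
  by apply/idP/idP; lia.
apply/esym/negbTE; apply/negP => /andP [].
by case: ifP => [/eqP h1|h1] /eqP h2 /eqP h3; lia.
Qed.

Lemma crank_count_sum (r : nat) :
  \sum_(k < n.+1) (Z (r + k)%N (n + 'C(r + k, 2)) - Z (r + k).+1 (n + 'C((r + k).+1, 2)))
  = Z r (n + 'C(r, 2)).
Proof.
transitivity (Z r (n + 'C(r, 2)) - Z (r + n.+1)%N (n + 'C(r + n.+1, 2))).
  elim: n.+1 => [|k IH]; first by rewrite big_ord0 addn0 subrr.
  by rewrite big_ord_recr /= IH addnS; lia.
by rewrite (@Z_eq0 (r + n.+1)) ?subr0 // binS bin1; lia.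
Qed.

Lemma partition_crank_bounds l : is_partition n l -> - n%:Z <= pcrank l <= n%:Z.
Proof.
move=> lP; have := partition_largest_le lP; have := partition_size_le lP.
have := count_ones_le lP; have := count_size (fun x => num_ones l < x)%N l.
by rewrite /pcrank; case: eqP => _; lia.
Qed.

Lemma count_crank_ge (r : nat) : (0 < r)%N ->
  (count (fun l => r%:Z <= pcrank l) L)%:Z = Z r (n + 'C(r, 2)).
Proof.
move=> r0; rewrite (@count_sum _ (fun l => `|pcrank l|%N - r)%N
  (fun k l => pcrank l == (r + k)%N%:Z) n.+1).
- rewrite (big_morph Posz PoszD (erefl _)) -crank_count_sum; apply: eq_bigr => k _.
  by rewrite count_crank_pos_eq //; lia.
- by move=> l /partL /partition_crank_bounds; lia.
by move=> l _ a an; lia.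
Qed.

Lemma count_crank_le (r : nat) : (0 < r)%N ->
  (count (fun l => pcrank l <= - r%:Z) L)%:Z = Z r (n + 'C(r, 2)).
Proof.
move=> r0; rewrite (@count_sum _ (fun l => `|pcrank l|%N - r)%N
  (fun k l => pcrank l == - (r + k)%N%:Z) n.+1).
- rewrite (big_morph Posz PoszD (erefl _)) -crank_count_sum; apply: eq_bigr => k _.
  by rewrite count_crank_neg_eq //; lia.
- by move=> l /partL /partition_crank_bounds; lia.
by move=> l _ a an; lia.
Qed.

End Counts.

(** * From counts to positions in the sorted lists *)

Lemma sorted_le_count (T : Type) (f : T -> int) (x0 : T) (L : seq T) (v : int) (i : nat) :
  sorted (fun a b => f a <= f b)%R L -> (i < size L)%N ->
  (f (nth x0 L i) <= v) = (i < count (fun a => f a <= v)%R L)%N.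
Proof.
elim: L i => //= x L IH i; rewrite path_sortedE; last by move=> a b c; exact: le_trans.
case/andP=> hx /IH {}IH; have [xv|xv] := leP (f x) v.
  by case: i => [|i]; rewrite ?xv // add1n !ltnS; exact: IH.
have -> : count (fun a => f a <= v)%R L = 0%N.
  apply/eqP; rewrite -leqn0 leqNgt -has_count -all_predC; apply: sub_all hx => y /= xy.
  by rewrite -ltNge (lt_le_trans xv xy).
case: i => [|i] /=; rewrite ?ltnS => iL; first by rewrite leNgt xv.
rewrite leNgt (lt_le_trans xv) //; exact: (all_nthP x0 hx).
Qed.

Definition count_le (f : seq nat -> int) (L : seq (seq nat)) (v : int) : nat :=
  count (fun l => f l <= v) L.

(** Nonnegative thresholds follow by complement from the counts of values at least m and m + 1;
    negative ones use the mirrored counts directly. *)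
Lemma rank_crank_counts n Lc Lr (cc := count_le pcrank Lc) (cr := count_le prank Lr) :
  (1 < n)%N -> enum_partitions n Lc -> enum_partitions n Lr ->
  [/\ forall m : nat, (cr (m%:Z - 1)%R <= cc m)%N /\ (cc m <= cr m)%N
    & forall m : nat, (cr (- m.+1%:Z)%R <= cc (- m.+1%:Z)%R)%N
                   /\ (cc (- m.+1%:Z)%R <= cr (- m%:Z)%R)%N].
Proof.
move=> n1 hc hr; have n0 : (0 < n)%N by lia.
have sz : size Lc = size Lr.
  apply/perm_size/uniq_perm; [exact: hc.1|exact: hr.1|].
  by move=> l; rewrite hc.2 hr.2.
have compl (f : seq nat -> int) (m : int) L :
    (count (fun l => f l <= m - 1)%R L + count (fun l => m <= f l)%R L = size L)%N.
  rewrite -[RHS](count_predC (fun l => f l <= m - 1)%R); congr (_ + _)%N.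
  by apply: eq_count => l /=; lia.
split=> m.
- have A := crank_ge_rank m n; have B := rank_ge_crank m n.
  have := compl prank m Lr; have := compl prank m.+1 Lr; have := compl pcrank m.+1 Lc.
  have := count_crank_ge n0 hc n1 (r := m.+1) isT.
  have := count_rank_ge n0 hr m; have := count_rank_ge n0 hr m.+1.
  by rewrite (_ : m.+1%:Z - 1 = m); [rewrite -/(count_le pcrank Lc _) -!/(count_le prank Lr _) -/cc -/cr; lia|lia].
- have A := crank_ge_rank m n; have B := rank_ge_crank m n.
  have := count_crank_le n0 hc n1 (r := m.+1) isT.
  have := count_rank_le n0 hr m; have := count_rank_le n0 hr m.+1.
  by rewrite -/(count_le pcrank Lc _) -!/(count_le prank Lr _) -/cc -/cr; lia.
Qed.

Local Close Scope ring_scope.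

(* Lc : partitions of n listed in weakly increasing crank (arbitrary ties);
   Lr : partitions of n listed in weakly increasing rank (arbitrary ties);
   tau_n(lambda) = the entry of Lr at the position of lambda in Lc. *)
Theorem theorem1p5 (n : nat) (Lc Lr : seq (seq nat)) :
  1 <= n ->
  enum_partitions n Lc ->
  sorted (fun a b => (pcrank a <= pcrank b)%R) Lc ->
  enum_partitions n Lr ->
  sorted (fun a b => (prank a <= prank b)%R) Lr ->
  forall lambda, is_partition n lambda ->
    let d := (pcrank lambda - prank (nth [::] Lr (index lambda Lc)))%R in
    (pcrank lambda = 0%R -> d = 0%R) /\
    ((0 < pcrank lambda)%R -> d = 0%R \/ d = 1%R) /\
    ((pcrank lambda < 0)%R -> d = 0%R \/ d = (-1)%R).
Proof.
move=> n0 hc sc hr sr l lP d.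
have lL : l \in Lc by rewrite hc.2.
have il : (index l Lc < size Lc)%N by rewrite index_mem.
have ir : (index l Lc < size Lr)%N.
  rewrite -(_ : size Lc = size Lr) //; apply/perm_size/uniq_perm; [exact: hc.1|exact: hr.1|].
  by move=> x; rewrite hc.2 hr.2.
(* Crank counts are not symmetric for n = 1. There [[:: 1]] is the only partition, with crank -1 and
   rank 0. *)
have [n1|n1] := leqP n 1.
  have n1' : n = 1%N by lia.
  have one x : is_partition n x -> x = [:: 1%N].
    rewrite n1' => xP; have := partition_size_le xP; have := @partition_nil 1 x isT xP.
    by case: x xP => [|y [|z x]] // /and3P [_ _ /= /eqP]; rewrite addn0 => ->.
  rewrite /d (one (nth _ _ _)); last by rewrite -hr.2 mem_nth.
  rewrite (one _ lP).
  by rewrite /pcrank /prank /=; split => //; split => // _; right.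
have [] := rank_crank_counts n1 hc hr.
set cc := count_le pcrank Lc; set cr := count_le prank Lr => H1 H2.
(* The entries of value at most v form a prefix of a sorted list, so both comparisons depend only on
   the common position, whatever the order of ties. *)
have Hc v : (pcrank l <= v)%R = (index l Lc < cc v)%N.
  by rewrite -(sorted_le_count [::] v sc il) nth_index.
have Hr v : (prank (nth [::] Lr (index l Lc)) <= v)%R = (index l Lc < cr v)%N.
  exact: sorted_le_count.
rewrite {}/d; move: Hc Hr; clearbody cc cr.
move: (prank (nth [::] Lr (index l Lc))) => w.
move: (pcrank l) (index l Lc) => v i Hc Hr.
(* In each case v <= v bounds w from above, and the failure of v <= v - 1 bounds it from below. *)
case: (intP v) Hc => [|m|m] Hc.
- have up : (w <= 0%N)%R by rewrite Hr (leq_trans _ (H1 0%N).2) // -Hc.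
  have lo : (- 1%:Z < w)%R.
    by rewrite ltNge Hr -leqNgt (leq_trans (H2 0%N).1) // leqNgt -Hc.
  lia.
- have up : (w <= m.+1)%R by rewrite Hr (leq_trans _ (H1 m.+1).2) // -Hc.
  have lo : (m%:Z - 1 < w)%R.
    by rewrite ltNge Hr -leqNgt (leq_trans (H1 m).1) // leqNgt -Hc; lia.
  lia.
- have up : (w <= - m%:Z)%R by rewrite Hr (leq_trans _ (H2 m).2) // -Hc.
  have lo : (- m.+2%:Z < w)%R.
    by rewrite ltNge Hr -leqNgt (leq_trans (H2 m.+1).1) // leqNgt -Hc; lia.
  lia.
Qed.
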